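(* Let $(X,d,\bar x)$ be a pointed metric space, $M\subseteq X$ a closed subspace with $\bar x\in M$, let $Z$ be a Banach space and let $K\ge1$. Assume that there exists a $K$-random projection $\{\upsilon_x:x\in X\}$ on $M$. Then there exists a bounded linear extension operator $$E:\mathrm{Lip}_0(M,Z)\to\mathrm{Lip}_0(X,Z)$$ with $\|E\|\le K$. In addition, $E$ is monotone if $\upsilon_x\in\mathcal{F}_+(M)$ for all $x\in X$.
   Context: $\mathrm{Lip}_0(X,Z)$ is the Banach space of $Z$-valued Lipschitz maps on $X$ vanishing at $\bar x$, normed by the Lipschitz constant; $\mathrm{Lip}_0(X)=\mathrm{Lip}_0(X,\mathbb{R})$; the same notation is used for $M$ with base point $\bar x$. The free (Arens-Eells) space $\mathcal{F}(M)$ is the norm closure of $\mathrm{span}\{\delta_x:x\in M\}$ in $\mathrm{Lip}_0(M)^*$, where $\delta_x(f)=f(x)$; it is a predual of $\mathrm{Lip}_0(M)$. $\mathcal{F}_+(M)$ is the set of $\upsilon\in\mathcal{F}(M)$ that are nondecreasing functionals, i.e. $\upsilon(f)\le\upsilon(g)$ whenever $f,g\in\mathrm{Lip}_0(M)$ and $f\le g$. For $\mu,\eta\in\mathcal{F}(M)$ set $W_1(\mu,\eta)=\|\mu-\eta\|_{\mathcal{F}(M)}=\sup\{\langle g,\mu-\eta\rangle:\ g\in\mathrm{Lip}_0(M),\ \|g\|_{Lip}\le1\}$. $K$-random projection on $M$ ($K\ge1$): a family $\{\upsilon_x:x\in X\}\subseteq\mathcal{F}(M)$ such that $\upsilon_x=\delta_x$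 for all $x\in M$ and $W_1(\upsilon_x,\upsilon_y)\le K\,d(x,y)$ for all $x,y\in X$. ''Extension operator'' means $E(f)|_M=f$ for every $f$. $E$ is the operator given by $\langle z^*,E(f)(x)\rangle=\upsilon_x(\langle z^*,f\rangle)$ for all $z^*\in Z^*$, $x\in X$. ''Monotone'' means: for $f\in\mathrm{Lip}_0(M,Z)$ and $z^*\in Z^*$, if $\langle z^*,f\rangle\ge0$ on $M$, then $\langle z^*,E(f)\rangle\ge0$ on $X$. *)

(* Defs.v *)
From HB Require Import structures.
From mathcomp Require Import all_boot all_order all_algebra.
From mathcomp Require Import all_classical all_reals all_analysis.
Import Order.TTheory GRing.Theory Num.Theory.
Import numFieldNormedType.Exports.

Set Implicit Arguments.
Unset Strict Implicit.
Unset Printing Implicit Defensive.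

Local Open Scope classical_set_scope.
Local Open Scope ring_scope.

(* The restriction to a subset of the distance of the ambient space, on top of
   the pseudometric structure that the library puts on [set_type]. *)
Section subset_metric.
Context {R : realType} {X : metricType R} (A : set X).

Let dist (x y : A) : R := mdist (set_val x) (set_val y).

Let dist_ge0 x y : 0 <= dist x y.
Proof. exact: mdist_ge0. Qed.

Let dist_positivity x y : dist x y = 0 -> x = y.
Proof. by move=> /mdist_positivity /val_inj. Qed.

Let ballEdist (x : A) d : ball x d = [set y | dist x y < d].
Proof. by rewrite -initial_ballE ballEmdist. Qed.

HB.instance Definition _ :=
  PseudoMetric_isMetric.Build R (set_type A) dist_ge0 dist_positivity ballEdist.

End subset_metric.

Section lip0_def.
Context {R : realType} {T : metricType R}.

Definition lip_bound {Z : normedModType R} (f : T -> Z) (L : R) : Prop :=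
  forall x y, `|f x - f y| <= L * mdist x y.

Context (t0 : T) (Z : normedModType R).

Definition lip0_pred : {pred T -> Z} :=
  mem [set f : T -> Z | f t0 = 0 /\ exists L, lip_bound f L].

(* [lip0 t0 Z] is Lip_0(T, Z) for the base point [t0]. *)
Record lip0 := MkLip0 { lip0_fun :> T -> Z; lip0_subproof : lip0_fun \in lip0_pred }.

HB.instance Definition _ := [isSub for lip0_fun].
HB.instance Definition _ := [Choice of lip0 by <:].

Lemma lip0_submod_closed : submod_closed lip0_pred.
Proof.
split; first by rewrite inE; split => //; exists 0 => x y; rewrite subrr normr0 mul0r.
move=> a f g; rewrite !inE => -[f0 [L fL]] [g0 [L' gL]]; split.
  by rewrite /= !fctE f0 g0 scaler0 addr0.
exists (`|a| * L + L') => x y; rewrite !fctE opprD addrACA -scalerBr.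
by rewrite (le_trans (ler_normD _ _))// mulrDl normrZ -mulrA lerD// ler_wpM2l.
Qed.

HB.instance Definition _ :=
  GRing.isSubmodClosed.Build R (T -> Z) lip0_pred lip0_submod_closed.
HB.instance Definition _ := [SubChoice_isSubLmodule of lip0 by <:].

Lemma lip0_base (f : lip0) : f t0 = 0.
Proof. by have := lip0_subproof f; rewrite inE => -[]. Qed.

Lemma lip0_lip (f : lip0) : exists L, lip_bound f L.
Proof. by have := lip0_subproof f; rewrite inE => -[]. Qed.

Lemma lip0P (f g : lip0) : (forall x, f x = g x) -> f = g.
Proof. by move=> fg; apply: val_inj; apply: funext. Qed.

Lemma lip0D (f g : lip0) x : (f + g) x = f x + g x. Proof. by []. Qed.

Lemma lip0Z a (f : lip0) x : (a *: f) x = a *: f x. Proof. by []. Qed.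

Definition lip_norm (f : lip0) : R := inf [set L | 0 <= L /\ lip_bound f L].

Let lip_set_neq0 (f : lip0) : [set L | 0 <= L /\ lip_bound f L] !=set0.
Proof.
have [L fL] := lip0_lip f; exists `|L|; split => // x y.
by rewrite (le_trans (fL x y))// ler_wpM2r ?mdist_ge0// ler_norm.
Qed.

Let lip_norm_ge0 (f : lip0) : 0 <= lip_norm f.
Proof. by apply: lb_le_inf; [exact: lip_set_neq0|move=> L []]. Qed.

Lemma lip_norm_le (f : lip0) L : 0 <= L -> lip_bound f L -> lip_norm f <= L.
Proof. by move=> L0 fL; apply: ge_inf => //; exists 0 => ? []. Qed.

Lemma lip_norm_bound (f : lip0) : lip_bound f (lip_norm f).
Proof.
move=> x y; have [->|xy] := eqVneq x y.
  by rewrite subrr normr0 mulr_ge0 ?lip_norm_ge0 ?mdist_ge0.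
have d0 : 0 < mdist x y by rewrite mdist_gt0.
rewrite -ler_pdivrMr//; apply: lb_le_inf; first exact: lip_set_neq0.
by move=> L [_ fL]; rewrite ler_pdivrMr.
Qed.

Let lip_normD f g : lip_norm (f + g) <= lip_norm f + lip_norm g.
Proof.
apply: lip_norm_le; first by rewrite addr_ge0.
move=> x y; rewrite !lip0D opprD addrACA (le_trans (ler_normD _ _))// mulrDl.
by rewrite lerD// lip_norm_bound.
Qed.

Let lip_normZ_le a f : lip_norm (a *: f) <= `|a| * lip_norm f.
Proof.
apply: lip_norm_le => [|x y]; first by rewrite mulr_ge0.
by rewrite !lip0Z -scalerBr normrZ -mulrA ler_wpM2l// lip_norm_bound.
Qed.

Let lip_normZ a f : lip_norm (a *: f) = `|a| * lip_norm f.
Proof.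
apply/eqP; rewrite eq_le lip_normZ_le/=; have [->|a0] := eqVneq a 0.
  by rewrite normr0 mul0r lip_norm_ge0.
rewrite -ler_pdivlMl ?normr_gt0// -normfV.
by rewrite -[in leLHS](scalerK a0 f) lip_normZ_le.
Qed.

Let lip_norm0_eq0 f : lip_norm f = 0 -> f = 0.
Proof.
move=> f0; apply: lip0P => x; apply/eqP; rewrite -normr_le0 -[f x]subr0.
by rewrite -(lip0_base f) (le_trans (lip_norm_bound _ _ _))// f0 mul0r.
Qed.

HB.instance Definition _ :=
  Lmodule_isNormed.Build R lip0 lip_normD lip_normZ lip_norm0_eq0.

Lemma lip0_normE (f : lip0) :
  `|f| = inf [set L | 0 <= L /\ lip_bound f L].
Proof. by []. Qed.

End lip0_def.

Section blin_def.
Context {R : realType} (V W : normedModType R).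

Definition blin_pred : {pred V -> W} :=
  mem [set f : V -> W | linear f /\ exists C, forall v, `|f v| <= C * `|v|].

(* Bounded linear operators, normed by the operator norm. *)
Record blin := MkBlin { blin_fun :> V -> W; blin_subproof : blin_fun \in blin_pred }.

HB.instance Definition _ := [isSub for blin_fun].
HB.instance Definition _ := [Choice of blin by <:].

Lemma blin_submod_closed : submod_closed blin_pred.
Proof.
split.
  rewrite inE; split; first by move=> a u v; rewrite [RHS]addr0 scaler0.
  by exists 0 => v; rewrite normr0 mul0r.
move=> a f g; rewrite !inE => -[fl [C fC]] [gl [D gD]]; split.
  move=> b u v; rewrite /= !fctE fl gl !scalerDr !scalerA (mulrC b a).
  by rewrite addrACA.
exists (`|a| * C + D) => v; rewrite !fctE (le_trans (ler_normD _ _))//.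
by rewrite mulrDl normrZ -mulrA lerD// ler_wpM2l.
Qed.

HB.instance Definition _ :=
  GRing.isSubmodClosed.Build R (V -> W) blin_pred blin_submod_closed.
HB.instance Definition _ := [SubChoice_isSubLmodule of blin by <:].

Lemma blin_linear (f : blin) : linear f.
Proof. by have := blin_subproof f; rewrite inE => -[]. Qed.

HB.instance Definition _ (f : blin) :=
  GRing.isLinear.Build R V W _ (blin_fun f) (blin_linear f).

Lemma blin_bounded (f : blin) : exists C, forall v, `|f v| <= C * `|v|.
Proof. by have := blin_subproof f; rewrite inE => -[]. Qed.

Lemma blinP (f g : blin) : (forall x, f x = g x) -> f = g.
Proof. by move=> fg; apply: val_inj; apply: funext. Qed.

Lemma blinD (f g : blin) x : (f + g) x = f x + g x. Proof. by []. Qed.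

Lemma blinZ a (f : blin) x : (a *: f) x = a *: f x. Proof. by []. Qed.

Definition op_norm (f : blin) : R := sup [set `|f v| | v in [set v | `|v| <= 1]].

Let op_has_sup (f : blin) : has_sup [set `|f v| | v in [set v | `|v| <= 1]].
Proof.
split; first by exists `|f 0|, 0 => //=; rewrite normr0.
have [C fC] := blin_bounded f; exists `|C| => _ [v /= v1 <-].
rewrite (le_trans (fC v))// (le_trans (ler_norm _))// normrM normr_id.
by rewrite ler_piMr.
Qed.

Let op_norm_ge0 (f : blin) : 0 <= op_norm f.
Proof.
apply: (le_trans (normr_ge0 (f 0))); apply: (sup_upper_bound (op_has_sup f)).
by exists 0 => //=; rewrite normr0.
Qed.

Lemma op_norm_bound (f : blin) v : `|f v| <= op_norm f * `|v|.
Proof.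
have [->|v0] := eqVneq v 0; first by rewrite linear0 !normr0 mulr0.
have nv : 0 < `|v| by rewrite normr_gt0.
rewrite -ler_pdivrMr//.
apply: (sup_upper_bound (op_has_sup f)); exists (`|v|^-1 *: v) => /=.
  by rewrite normrZ normfV normr_id mulVf// gt_eqF.
by rewrite linearZ normrZ normfV normr_id mulrC.
Qed.

Lemma op_norm_le (f : blin) C :
  0 <= C -> (forall v, `|f v| <= C * `|v|) -> op_norm f <= C.
Proof.
move=> C0 fC; apply: ge_sup; first by case: (op_has_sup f).
by move=> _ [v /= v1 <-]; rewrite (le_trans (fC v))// ler_piMr.
Qed.

Let op_normD f g : op_norm (f + g) <= op_norm f + op_norm g.
Proof.
apply: op_norm_le; first by rewrite addr_ge0.
move=> v; rewrite blinD (le_trans (ler_normD _ _))// mulrDl.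
by rewrite lerD// op_norm_bound.
Qed.

Let op_normZ_le a f : op_norm (a *: f) <= `|a| * op_norm f.
Proof.
apply: op_norm_le => [|v]; first by rewrite mulr_ge0.
by rewrite blinZ normrZ -mulrA ler_wpM2l// op_norm_bound.
Qed.

Let op_normZ a f : op_norm (a *: f) = `|a| * op_norm f.
Proof.
apply/eqP; rewrite eq_le op_normZ_le/=; have [->|a0] := eqVneq a 0.
  by rewrite normr0 mul0r op_norm_ge0.
rewrite -ler_pdivlMl ?normr_gt0// -normfV.
by rewrite -[in leLHS](scalerK a0 f) op_normZ_le.
Qed.

Let op_norm0_eq0 f : op_norm f = 0 -> f = 0.
Proof.
move=> f0; apply: blinP => x; apply/eqP; rewrite -normr_le0.
by rewrite (le_trans (op_norm_bound _ _))// f0 mul0r.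
Qed.

HB.instance Definition _ :=
  Lmodule_isNormed.Build R blin op_normD op_normZ op_norm0_eq0.

Lemma blin_normE (f : blin) :
  `|f| = sup [set `|f v| | v in [set v | `|v| <= 1]].
Proof. by []. Qed.

End blin_def.

Definition dual {R : realType} (V : normedModType R) := blin V R.

Section free_space.
Context {R : realType} {T : metricType R} (t0 : T).

Let delta_subproof (x : T) :
  (fun f : lip0 t0 R => f x : R) \in @blin_pred _ _ _.
Proof.
rewrite inE; split => //; exists (mdist x t0) => f.
by rewrite -[f x]subr0 -(lip0_base f) mulrC; exact: lip_norm_bound.
Qed.

Definition delta (x : T) : dual (lip0 t0 R) := MkBlin (delta_subproof x).

Definition span_delta : set (dual (lip0 t0 R)) :=
  [set mu | exists s : seq (R * T), mu = \sum_(p <- s) p.1 *: delta p.2].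

Definition free_space : set (dual (lip0 t0 R)) := closure span_delta.

Definition free_space_pos : set (dual (lip0 t0 R)) :=
  [set mu | free_space mu /\
    forall f g : lip0 t0 R, (forall x, f x <= g x) -> mu f <= mu g].

Definition W1 (mu eta : dual (lip0 t0 R)) : R := `|mu - eta|.

End free_space.

Section dual_comp.
Context {R : realType} {T : metricType R} {t0 : T} {Z : normedModType R}.

Let dual_comp_subproof (zs : dual Z) (f : lip0 t0 Z) :
  (fun x => zs (f x)) \in @lip0_pred _ _ t0 _.
Proof.
rewrite inE; split; first by rewrite /= lip0_base linear0.
exists (`|zs| * `|f|) => x y; rewrite -linearB -mulrA.
apply: (le_trans (op_norm_bound _ _)); apply: ler_wpM2l.
  exact: (normr_ge0 zs).
exact: (lip_norm_bound f x y).
Qed.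

(* The scalar Lipschitz function <z*, f>. *)
Definition dual_comp (zs : dual Z) (f : lip0 t0 Z) : lip0 t0 R :=
  MkLip0 (dual_comp_subproof zs f).

End dual_comp.

Section projection_extension.
Context {R : realType} {X : metricType R} {xbar : X} {M : set X}.

Definition sub_pt (x : X) (Mx : M x) : M := exist _ x (mem_set Mx).

Context (Mxbar : M xbar).

Definition random_projection (K : R)
    (nu : X -> dual (lip0 (sub_pt Mxbar) R)) : Prop :=
  [/\ forall x, free_space (nu x),
      forall x : M, nu (set_val x) = delta (sub_pt Mxbar) x
    & forall x y, W1 (nu x) (nu y) <= K * mdist x y].

Context {Z : normedModType R}.

Definition extension_operator
    (E : blin (lip0 (sub_pt Mxbar) Z) (lip0 xbar Z)) : Prop :=
  forall f (x : M), E f (set_val x) = f x.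

Definition monotone_operator
    (E : blin (lip0 (sub_pt Mxbar) Z) (lip0 xbar Z)) : Prop :=
  forall (f : lip0 (sub_pt Mxbar) Z) (zs : dual Z),
    (forall x : M, 0 <= zs (f x)) -> forall x : X, 0 <= zs (E f x).

End projection_extension.

(* Main.v *)
(** For a finite combination [mu] of Dirac functionals, the vector
    [sum_i a_i f(x_i)] of [Z] represents [z* |-> mu(<z*, f>)]. A norming
    functional (Hahn-Banach) shows that representing vectors satisfy
    [|z - w| <= |mu - eta| |f|]; hence they depend only on [mu], and by
    completeness of [Z] they exist for every [mu] in the norm closure of these
    combinations. [E f x] is the vector representing [nu x] at [f], and the same
    estimate gives its Lipschitz constant. *)

Require Import Defs.
From HB Require Import structures.
From mathcomp Require Import all_boot all_order all_algebra.
From mathcomp Require Import all_classical all_reals all_analysis.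
Import Order.TTheory GRing.Theory Num.Theory.
Import numFieldNormedType.Exports.
Local Open Scope classical_set_scope.
Local Open Scope ring_scope.

(** * Sublinear functionals and linear minorants, in the style of Hahn-Banach *)

Definition sublinear {R : realType} {V : lmodType R} (p : V -> R) : Prop :=
  (forall u v, p (u + v) <= p u + p v) /\
  (forall t v, 0 <= t -> p (t *: v) <= t * p v).

Section sublinear_functionals.
Context {R : realType} {V : lmodType R}.
Implicit Types (p : V -> R) (u v w : V).

(** For [t > 0] the reverse inequality is homogeneity at [t^-1]; for [t = 0] it follows from
    [p (0 + 0) <= p 0 + p 0]. *)
Lemma sublinearZ p t v : sublinear p -> 0 <= t -> p (t *: v) = t * p v.
Proof.
move=> [pD pZ] t0; apply/eqP; rewrite eq_le pZ//=.
have [<-|tN0] := eqVneq 0 t.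
  rewrite mul0r scale0r -(lerD2l (p 0)) addr0 -[in leLHS](addr0 0).
  exact: pD.
have tgt0 : 0 < t by rewrite lt_def eq_sym tN0.
rewrite -ler_pdivlMl// -[in leLHS](scalerK (a := t) _ v) 1?eq_sym//.
by rewrite pZ// invr_ge0.
Qed.

Lemma sublinear0 p : sublinear p -> p 0 = 0.
Proof. by move=> sp; rewrite -(scale0r 0) sublinearZ// mul0r. Qed.

Lemma sublinear_geN p v : sublinear p -> - p (- v) <= p v.
Proof.
move=> sp; have := (proj1 sp) v (- v).
by rewrite subrr sublinear0// -[_ <= p v]subr_ge0 opprK.
Qed.

(** Oddness turns subadditivity at [- u], [- v] into superadditivity at [u], [v]. *)
Lemma odd_sublinear_scalar p :
  sublinear p -> (forall v, p (- v) <= - p v) -> scalar p.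
Proof.
move=> sp p_odd; have pN v : p (- v) = - p v.
  by apply/eqP; rewrite eq_le p_odd lerNl sublinear_geN.
have pD u v : p (u + v) = p u + p v.
  apply/eqP; rewrite eq_le (proj1 sp)/= -lerN2 -pN !opprD -!pN.
  exact: (proj1 sp).
move=> t u v; rewrite pD; congr (_ + _).
have [t0|t0] := leP 0 t; first exact: sublinearZ.
by rewrite -[t]opprK scaleNr pN sublinearZ ?oppr_ge0 ?ltW// !mulNr.
Qed.

(** Common to shears and to infima of chains: passing to the infimum in [a], then in [b], needs only
    some element of [S (u + v)] below each [a + b]. *)
Lemma sublinear_inf (S : V -> set R) :
  (forall v, has_inf (S v)) ->
  (forall u v a b, S u a -> S v b -> exists2 c, S (u + v) c & c <= a + b) ->
  (forall t v a, 0 <= t -> S v a -> exists2 c, S (t *: v) c & c <= t * a) ->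
  sublinear (fun v => inf (S v)).
Proof.
move=> Sinf SD SZ; split=> [u v|t v t0].
  rewrite -lerBlDr; apply: lb_le_inf; first by case: (Sinf u).
  move=> a Sa; rewrite lerBlDr -lerBlDl.
  apply: lb_le_inf; first by case: (Sinf v).
  move=> b Sb; rewrite lerBlDl; have [c Sc] := SD _ _ _ _ Sa Sb.
  by apply: le_trans; apply: ge_inf => //; case: (Sinf (u + v)).
have infZ a : S v a -> inf (S (t *: v)) <= t * a.
  move=> Sa; have [c Sc] := SZ _ _ _ t0 Sa.
  by apply: le_trans; apply: ge_inf => //; case: (Sinf (t *: v)).
have [[a Sa] _] := Sinf v.
(* Dividing by [t] is impossible when [t = 0]; there any member [a] gives the bound [0 * a]. *)
have [t00|tN0] := eqVneq t 0.
  by rewrite (le_trans (infZ _ Sa))// t00 !mul0r.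
rewrite -ler_pdivrMl ?lt_def ?tN0//; apply: lb_le_inf; first by exists a.
by move=> b Sb; rewrite ler_pdivrMl ?lt_def ?tN0// infZ.
Qed.

(** Take for [q v] the infimum of [p (v + t *: w) - t * p w] over [t >= 0]: [t = 0] gives [q <= p],
    and [t = 1] at [v = - w] gives the last bound. *)
Lemma sublinear_shear p w : sublinear p -> exists q,
  [/\ sublinear q, forall v, q v <= p v & q (- w) <= - p w].
Proof.
move=> sp; pose S v := [set p (v + t *: w) - t * p w | t in [set t | 0 <= t]].
(* The infimum is finite because [t * p w = p (t *: w) <= p (v + t *: w) + p (- v)]. *)
have S_lb v : lbound (S v) (- p (- v)).
  move=> _ [t /= t0 <-]; rewrite -sublinearZ// lerBrDr addrC lerBlDr.
  have := (proj1 sp) (v + t *: w) (- v).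
  by rewrite addrAC subrr add0r.
have S_inf v : has_inf (S v).
  by split; [exists (p (v + 0 *: w) - 0 * p w), 0 => /=|exists (- p (- v))].
exists (fun v => inf (S v)); split.
- apply: sublinear_inf => // [u v _ _ [s /= s0 <-] [t /= t0 <-]|].
    exists (p (u + v + (s + t) *: w) - (s + t) * p w).
      by exists (s + t) => //=; rewrite addr_ge0.
    by rewrite mulrDl opprD scalerDl addrACA [leRHS]addrACA lerD2r (proj1 sp).
  move=> t v _ t0 [s /= s0 <-].
  exists (p (t *: v + (t * s) *: w) - (t * s) * p w).
    by exists (t * s) => //=; rewrite mulr_ge0.
  by rewrite -scalerA -scalerDr mulrBr -mulrA lerD2r (proj2 sp).
- move=> v; apply: ge_inf; first by case: (S_inf v).
  by exists 0 => /=; rewrite // scale0r mul0r addr0 subr0.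
- apply: ge_inf; first by case: (S_inf (- w)).
  exists 1 => /=; first exact: ler01.
  by rewrite scale1r mul1r addNr sublinear0// sub0r.
Qed.

(* A minimal sublinear functional is linear: shearing it along [w] gives a
   smaller one, so that minimality forces [p (- w) <= - p w]. *)
Lemma sublinear_dominates_scalar p0 :
  sublinear p0 -> exists2 p, scalar p & forall v, p v <= p0 v.
Proof.
move=> sp0; pose below p := sublinear p /\ forall v, p v <= p0 v.
pose T := {p : V -> R | below p}.
(* The order is reversed, so that a maximal element for Zorn's lemma is a minimal functional. *)
pose le_T (p q : T) := `[< forall v, sval q v <= sval p v >].
have [|||D Dtot|[p [sp pp0]] pmin] := @Zorn T le_T.
- by move=> p; apply/asboolP.
- move=> p q r /asboolP pq /asboolP qr; apply/asboolP => v.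
  exact: le_trans (pq v).
- move=> [p sp] [q sq] /asboolP/= pq /asboolP/= qp; apply: eq_exist.
  by apply/funext => v; apply/eqP; rewrite eq_le pq qp.
- have [->|/set0P[r Dr]] := eqVneq D set0.
    by exists (exist below p0 (conj sp0 (fun=> lexx _))).
  pose S v := [set sval q v | q in D].
  have S_lb v : lbound (S v) (- p0 (- v)).
    move=> _ [[q [sq qp0]] _ <-] /=.
    by rewrite (le_trans _ (sublinear_geN _ _ sq))// lerN2.
  have S_inf v : has_inf (S v).
    by split; [exists (sval r v), r|exists (- p0 (- v))].
  have S_le q v : D q -> inf (S v) <= sval q v.
    by move=> Dq; apply: ge_inf; [case: (S_inf v)|exists q].
  have sS : sublinear (fun v => inf (S v)).
    apply: sublinear_inf => // [u v _ _ [q1 D1 <-] [q2 D2 <-]|].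
      (* The smaller of the two functionals serves at both [u] and [v]. *)
      have [/asboolP q12|/asboolP q21] := Dtot _ _ D1 D2.
        exists (sval q2 (u + v)); first by exists q2.
        by rewrite (le_trans (proj1 (proj1 (svalP q2)) _ _))// lerD2r.
      exists (sval q1 (u + v)); first by exists q1.
      by rewrite (le_trans (proj1 (proj1 (svalP q1)) _ _))// lerD2l.
    move=> t v _ t0 [q Dq <-]; exists (sval q (t *: v)); first by exists q.
    exact: (proj2 (proj1 (svalP q))).
  have Sp0 v : inf (S v) <= p0 v.
    exact: le_trans (S_le r v Dr) (proj2 (svalP r) v).
  exists (exist below _ (conj sS Sp0)) => q Dq.
  by apply/asboolP => v; exact: S_le.
- exists p => //; apply: odd_sublinear_scalar => // w.
  have [q [sq qp qw]] := sublinear_shear _ w sp.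
  have qp0 v : q v <= p0 v by exact: le_trans (qp v) (pp0 v).
  have /(congr1 sval)/= qpE :
      exist below q (conj sq qp0) = exist below p (conj sp pp0).
    by apply: pmin; exact/asboolP.
  by rewrite -{1}qpE.
Qed.

End sublinear_functionals.

(** * Norming functionals *)

Section norming.
Context {R : realType} {Z : normedModType R}.

(** Shear the norm along [z] and take a linear [p] below the result: [p] is dominated by the norm,
    and [p (- z) <= - |z|] forces [p z >= |z|]. *)
Lemma norming_functional (z : Z) :
  exists2 zs : dual Z, `|zs| <= 1 & zs z = `|z|.
Proof.
have snorm : sublinear (fun v : Z => `|v|).
  by split=> [u v|t v t0]; [exact: ler_normD|rewrite normrZ ger0_norm].
have [q [sq q_norm qz]] := sublinear_shear _ z snorm.
have [p p_lin pq] := sublinear_dominates_scalar _ sq.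
pose pL : {scalar Z} := HB.pack p (GRing.isLinear.Build R Z R _ p p_lin).
have pN v : p (- v) = - p v by exact: (linearN pL).
have p_norm v : `|p v| <= 1 * `|v|.
  rewrite mul1r ler_norml (le_trans (pq v))// andbT lerNl -pN.
  by rewrite (le_trans (pq _))// (le_trans (q_norm _))// normrN.
have p_blin : p \in @blin_pred R Z R.
  by rewrite inE; split => //; exists 1.
exists (MkBlin p_blin); first exact: (op_norm_le ler01).
apply/eqP; rewrite eq_le /= (le_trans (pq z)) ?q_norm//=.
by rewrite -lerN2 -pN (le_trans (pq _)).
Qed.

Lemma dual_separates (u v : Z) : (forall zs : dual Z, zs u = zs v) -> u = v.
Proof.
move=> uv; have [zs _ zsB] := norming_functional (u - v).
by apply/eqP; rewrite -subr_eq0 -normr_eq0 -zsB linearB/= uv subrr.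
Qed.

End norming.
Lemma blinB {R : realType} {V W : normedModType R} (f g : blin V W) (v : V) :
  (f - g) v = f v - g v.
Proof. by []. Qed.

(** * Integration of vector-valued Lipschitz maps against free-space elements *)

Section weak_integral.
Context {R : realType} {T : metricType R} {t0 : T}.

(* [z] is the vector [mu(f)], defined by duality. *)
Definition weak_integral {Z : normedModType R} (mu : dual (lip0 t0 R))
    (f : lip0 t0 Z) (z : Z) : Prop :=
  forall zs : dual Z, zs z = mu (dual_comp zs f).

Section normed.
Context {Z : normedModType R}.
Implicit Types (mu eta : dual (lip0 t0 R)) (f g : lip0 t0 Z) (z w : Z).

Lemma dual_comp_norm_le (zs : dual Z) f : `|dual_comp zs f| <= `|zs| * `|f|.
Proof.
apply: lip_norm_le => [|x y]; first by rewrite mulr_ge0.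
rewrite /= -linearB -mulrA (le_trans (op_norm_bound _ _))//.
by apply: ler_wpM2l; [exact: (normr_ge0 zs)|exact: lip_norm_bound].
Qed.

(** A functional norming [z - w] reduces this to a scalar estimate. It yields both the Cauchy
    property in the limit argument and the Lipschitz bound of the extension. *)
Lemma weak_integral_dist mu eta f z w :
  weak_integral mu f z -> weak_integral eta f w ->
  `|z - w| <= `|mu - eta| * `|f|.
Proof.
move=> muz etaw; have [zs zs1 <-] := norming_functional (z - w).
rewrite linearB/= muz etaw -blinB.
rewrite (le_trans (ler_norm _))// (le_trans (op_norm_bound _ _))//.
apply: ler_wpM2l; first exact: (normr_ge0 (mu - eta)).
by rewrite (le_trans (dual_comp_norm_le _ _))// ler_piMl.
Qed.

Lemma weak_integral_unique mu f z w :
  weak_integral mu f z -> weak_integral mu f w -> z = w.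
Proof. by move=> muz muw; apply: dual_separates => zs; rewrite muz muw. Qed.

Lemma weak_integral_linear mu a f g z w :
  weak_integral mu f z -> weak_integral mu g w ->
  weak_integral mu (a *: f + g) (a *: z + w).
Proof.
move=> muz muw zs; rewrite linearP/= muz muw -linearP; congr (mu _).
by apply: lip0P => x /=; rewrite linearP.
Qed.

Lemma weak_integral_delta (x : T) f : weak_integral (delta t0 x) f (f x).
Proof. by []. Qed.

Lemma weak_integral_span mu f :
  span_delta mu -> exists z, weak_integral mu f z.
Proof.
move=> [s ->]; exists (\sum_(p <- s) p.1 *: f p.2) => zs.
elim: s => [|p s IHs]; first by rewrite !big_nil linear0.
by rewrite !big_cons linearP/= IHs.
Qed.

End normed.

Lemma weak_integral_free_space {Z : completeNormedModType R}
    (mu : dual (lip0 t0 R)) (f : lip0 t0 Z) :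
  free_space mu -> exists z, weak_integral mu f z.
Proof.
move=> mu_free.
(* Neighbourhoods of [mu] traced on the span; the trace is proper because [mu] lies in the
   closure. *)
pose F := within (@span_delta _ _ t0) (nbhs mu).
have FF : ProperFilter F by exact: within_nbhs_proper.
have [g gP] : {g : dual (lip0 t0 R) -> Z &
    forall eta, span_delta eta -> weak_integral eta f (g eta)}.
  apply: (@choice _ _ (fun eta z => span_delta eta -> weak_integral eta f z)).
  move=> eta; have [spe|nspe] := pselect (span_delta eta).
    by have [z etaz] := weak_integral_span _ f spe; exists z.
  (* An arbitrary value off the span, which [F] does not see. *)
  by exists 0.
(* Adding 1 keeps the divisor positive when [f = 0]. *)
have f1 : 0 < `|f| + 1 by rewrite ltr_wpDl.
have F_near e : 0 < e -> F [set eta | span_delta eta /\ `|mu - eta| < e].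
  move=> e0; have mu_ball : nbhs mu (ball mu e) by exact: nbhsx_ballx.
  apply: (@filterS _ (nbhs mu) _ _ _ _ mu_ball) => eta.
  by rewrite -ball_normE.
have gF : cvg (g @ F).
  apply/cauchy_cvgP/cauchy_exP => _/posnumP[e].
  have e2 : 0 < e%:num / 2 / (`|f| + 1) by rewrite !divr_gt0.
  have [eta [spe mu_eta]] := filter_ex (F_near _ e2).
  exists (g eta); apply: filterS (F_near _ e2) => th [spt mu_th].
  have g_dist := weak_integral_dist _ _ _ _ _ (gP _ spe) (gP _ spt).
  rewrite -ball_normE /= (le_lt_trans g_dist)//.
  have : `|eta - th| < e%:num / (`|f| + 1).
    rewrite -(subrK mu eta) -addrA (le_lt_trans (ler_normD _ _))//.
    by rewrite [e%:num]splitr mulrDl ltrD// distrC.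
  move=> /ltW/(ler_wpM2r (normr_ge0 f)) /le_lt_trans; apply.
  by rewrite mulrAC ltr_pdivrMr// ltr_pM2l// ltrDl.
exists (lim (g @ F)) => zs; apply/eqP; rewrite -subr_eq0 -normr_le0.
apply/ler_addgt0Pl => _/posnumP[e]; rewrite addr0.
(* Chosen so that the two error terms, each carrying a factor [e / c], add up to at most [e]. *)
pose c := `|zs| + `|dual_comp zs f| + 1.
have c0 : 0 < c by rewrite /c ltr_wpDl// addr_ge0.
have ec : 0 < e%:num / c by rewrite divr_gt0.
have [eta [lim_eta [spe mu_eta]]] :=
  filter_ex (filterI (cvgr_dist_lt _ _ gF _ ec) (F_near _ ec)).
(* The common value [zs (g eta) = eta (dual_comp zs f)] is inserted. *)
have -> : zs (lim (g @ F)) - mu (dual_comp zs f) =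
    zs (lim (g @ F) - g eta) - (mu - eta) (dual_comp zs f).
  by rewrite blinB linearB/= (gP _ spe zs) opprB addrA subrK.
rewrite (le_trans (ler_normB _ _))//.
apply: (@le_trans _ _ (`|zs| * (e%:num / c) + e%:num / c * `|dual_comp zs f|)).
  apply: lerD; apply: (le_trans (op_norm_bound _ _)).
    by apply: ler_wpM2l; [exact: (normr_ge0 zs)|exact: ltW].
  by apply: ler_wpM2r => //; exact: ltW.
rewrite mulrC -mulrDr mulrAC ler_pdivrMr// ler_pM2l//.
by rewrite /c lerDl.
Qed.

End weak_integral.

Theorem theorem2p14 (R : realType) (X : metricType R) (xbar : X) (M : set X)
    (Mclosed : closed M) (Mxbar : M xbar) (Z : completeNormedModType R)
    (K : R) (K1 : 1 <= K)
    (nu : X -> dual (lip0 (sub_pt Mxbar) R))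
    (nuK : random_projection K nu) :
  exists E : blin (lip0 (sub_pt Mxbar) Z) (lip0 xbar Z),
    [/\ extension_operator E,
        `|E| <= K,
        forall (f : lip0 (sub_pt Mxbar) Z) (zs : dual Z) (x : X),
          zs (E f x) = nu x (dual_comp zs f)
      & (forall x, free_space_pos (nu x)) -> monotone_operator E].
Proof.
have [nu_free nu_delta nu_lip] := nuK.
have K0 : 0 <= K by exact: le_trans K1.
(* One choice over all pairs [(f, x)]; uniqueness of representing vectors then gives the extension
   property and linearity in [f]. *)
have [E EP] : {E : lip0 (sub_pt Mxbar) Z * X -> Z &
    forall fx, weak_integral (nu fx.2) fx.1 (E fx)}.
  apply: (@choice _ _ (fun fx z => weak_integral (nu fx.2) fx.1 z)) => -[f x].
  exact: weak_integral_free_space.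
have E_ext f (x : M) : E (f, set_val x) = f x.
  apply: (weak_integral_unique _ _ _ _ (EP (f, set_val x))) => zs /=.
  by rewrite nu_delta.
have E_lip f : lip_bound (fun x => E (f, x)) (K * `|f|).
  move=> x y.
  rewrite (le_trans (weak_integral_dist _ _ _ _ _ (EP (f, x)) (EP (f, y))))//=.
  by rewrite mulrAC ler_wpM2r// nu_lip.
have E_lip0 f : (fun x => E (f, x)) \in @lip0_pred R X xbar Z.
  rewrite inE; split; last by exists (K * `|f|).
  (* [xbar] is the image of the base point of [M], where the extension agrees with [f]. *)
  by rewrite -[RHS](lip0_base f) -E_ext.
pose E0 f := MkLip0 (E_lip0 f).
have E0_norm f : `|E0 f| <= K * `|f|.
  by apply: lip_norm_le; [rewrite mulr_ge0|exact: E_lip].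
have E0_blin : E0 \in @blin_pred R _ _.
  rewrite inE; split=> [a f g|]; last by exists K.
  apply: lip0P => x.
  apply: (weak_integral_unique _ _ _ _ (EP (_, x))).
  exact: (weak_integral_linear _ _ _ _ _ _ (EP (f, x)) (EP (g, x))).
exists (MkBlin E0_blin); split.
- by move=> f x; exact: E_ext.
- exact (@op_norm_le _ _ _ (MkBlin E0_blin) K K0 E0_norm).
- by move=> f zs x; exact: (EP (f, x)).
- move=> nu_pos f zs zsf x; rewrite (EP (f, x) zs) /=.
  have [_ nu_mono] := nu_pos x.
  (* Monotonicity is applied to the pair [0 <= dual_comp zs f]. *)
  by rewrite -(linear0 (nu x)); exact: nu_mono.
Qed.
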